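(* Let $S$ be a rectangular band semigroup and let $\omega$ be a weight on $S$. Then $\ell^{1}(S,\omega)$ is amenable if and only if $S$ is a singleton.
   Context: A rectangular band semigroup is a semigroup $S$ with $s^2=s$ and $sts=s$ for all $s,t\in S$. A weight on $S$ is a function $\omega:S\to(0,\infty)$ with $\omega(st)\le\omega(s)\omega(t)$. The Beurling algebra $\ell^{1}(S,\omega)$ is the space of $f=\sum_s f(s)\delta_s$ with $\|f\|_\omega=\sum_s|f(s)|\omega(s)<\infty$, with convolution $\delta_s*\delta_t=\delta_{st}$. A Banach algebra $\mathcal{A}$ is amenable if for every Banach $\mathcal{A}$-bimodule $E$, every bounded derivation $\mathcal{A}\to E^*$ is inner. *)

(* Defs.v *)
From HB Require Import structures.
From mathcomp Require Import all_boot all_order all_algebra.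
From mathcomp Require Import all_classical all_reals all_analysis.
From mathcomp Require Import finmap complex.
Import numFieldNormedType.Exports.
Set Implicit Arguments.
Unset Strict Implicit.
Unset Printing Implicit Defensive.
Import Order.TTheory GRing.Theory Num.Theory.
Local Open Scope classical_set_scope.
Local Open Scope ring_scope.

(* Unconditional sums over an arbitrary (choice) index type: the limit *)
(* of the net of finite partial sums, finite sets ordered by inclusion *)
(* (as in mathcomp-analysis' showcase/summability.v).                  *)
Definition totally {I : choiceType} : set_system {fset I} :=
  filter_from setT (fun A => [set B | (A `<=` B)%fset]).

Instance totally_filter {I : choiceType} : ProperFilter (@totally I).
Proof.
eapply filter_from_proper; last by move=> A _; exists A; rewrite /= fsubset_refl.
apply: filter_fromT_filter; first by exists fset0.
by move=> A B /=; exists (A `|` B)%fset => P /=; rewrite fsubUset => /andP[].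
Qed.

Definition partial_sum {I : choiceType} {V : zmodType}
  (x : I -> V) (A : {fset I}) : V := \sum_(i <- A) x i.

Definition usum {I : choiceType} {K : numFieldType} {V : normedModType K}
  (x : I -> V) : V := lim (partial_sum x @ totally).

(* Amenability of a Banach algebra.  The algebra is given by a carrier *)
(* predicate [inA] inside a K-vector space [V], a norm [nA] and a      *)
(* product [mulA].                                                     *)
Section Amenability.
Variables (K : numFieldType) (V : lmodType K) (inA : V -> Prop)
  (nA : V -> K) (mulA : V -> V -> V).

Definition bdd_functional (E : normedModType K) (phi : E -> K) :=
  [/\ forall x y : E, phi (x + y) = phi x + phi y,
      forall (k : K) (x : E), phi (k *: x) = k * phi x &
      exists c : K, forall x : E, `|phi x| <= c * `|x| ].

Definition banach_bimodule (E : completeNormedModType K)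
    (la : V -> E -> E) (ra : E -> V -> E) :=
  [/\
      [/\ forall a b x, inA a -> inA b -> la (a + b) x = la a x + la b x,
          forall (k : K) a x, inA a -> la (k *: a) x = k *: la a x,
          forall a x y, inA a -> la a (x + y) = la a x + la a y &
          forall (k : K) a x, inA a -> la a (k *: x) = k *: la a x],
      [/\ forall a b x, inA a -> inA b -> ra x (a + b) = ra x a + ra x b,
          forall (k : K) a x, inA a -> ra x (k *: a) = k *: ra x a,
          forall a x y, inA a -> ra (x + y) a = ra x a + ra y a &
          forall (k : K) a x, inA a -> ra (k *: x) a = k *: ra x a],
      [/\ forall a b x, inA a -> inA b -> la (mulA a b) x = la a (la b x),
          forall a b x, inA a -> inA b -> ra x (mulA a b) = ra (ra x a) b &
          forall a b x, inA a -> inA b -> ra (la a x) b = la a (ra x b)] &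
      exists c : K, forall a x, inA a ->
         `|la a x| <= c * nA a * `|x| /\ `|ra x a| <= c * nA a * `|x| ].

(* D : A -> E^*, encoded as D a x = <x, D a>, is a bounded derivation,
   where E^* carries the dual module actions
   <x, a . phi> = <x . a, phi>  and  <x, phi . a> = <a . x, phi>. *)
Definition bdd_derivation (E : completeNormedModType K)
    (la : V -> E -> E) (ra : E -> V -> E) (D : V -> E -> K) :=
  [/\ forall a, inA a -> bdd_functional (D a),
      forall a b x, inA a -> inA b -> D (a + b) x = D a x + D b x,
      forall (k : K) a x, inA a -> D (k *: a) x = k * D a x,
      exists c : K, forall a x, inA a -> `|D a x| <= c * nA a * `|x| &
      forall a b x, inA a -> inA b ->
        D (mulA a b) x = D b (ra x a) + D a (la b x) ].

(* D is inner: D = ad_phi, ad_phi a = a . phi - phi . a, phi in E^* *)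
Definition inner_derivation (E : completeNormedModType K)
    (la : V -> E -> E) (ra : E -> V -> E) (D : V -> E -> K) :=
  exists phi : E -> K, bdd_functional phi /\
    forall a x, inA a -> D a x = phi (ra x a) - phi (la a x).

Definition amenable :=
  forall (E : completeNormedModType K) (la : V -> E -> E) (ra : E -> V -> E),
    banach_bimodule la ra ->
    forall D : V -> E -> K, bdd_derivation la ra D -> inner_derivation la ra D.

End Amenability.

Definition rectangular_band (S : Type) (op : S -> S -> S) :=
  [/\ associative op, forall s, op s s = s & forall s t, op (op s t) s = s].

Definition is_weight (R : realType) (S : Type) (op : S -> S -> S)
    (w : S -> R) :=
  (forall s, 0 < w s) /\ (forall s t, w (op s t) <= w s * w t).

Section Beurling.
Variables (R : realType) (S : choiceType) (op : S -> S -> S) (w : S -> R).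
Local Notation C := (R[i] : numFieldType).

Definition wC (s : S) : C := real_complex R (w s).

Definition in_l1 (f : S -> C) : Prop :=
  exists M : C, forall J : {fset S}, \sum_(s <- J) `|f s| * wC s <= M.

Definition l1norm (f : S -> C) : C := usum (fun s => `|f s| * wC s).

(* convolution: (f * g)(u) = sum_{st = u} f(s) g(t),
   i.e. the product determined by delta_s * delta_t = delta_{st} *)
Definition conv (f g : S -> C) : S -> C :=
  fun u => usum (fun p : S * S => if op p.1 p.2 == u then f p.1 * g p.2 else 0).

Definition beurling_amenable : Prop :=
  @amenable C (S -> C) in_l1 l1norm conv.

End Beurling.

(* Main.v *)
(** On [l1(S, w)] the weight is at least [1], so every bounded function [g] on
    [S] defines a bounded functional [a |-> sum_s a(s) g(s)].  Let [C] be the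
    bimodule on which [l1(S, w)] acts from the left by the augmentation
    character and from the right by zero.  If [g(st) = g(s)], then [g] gives a
    derivation into its dual, and inner derivations are the multiples of the
    augmentation; so amenability forces [g] to be constant.  In a rectangular
    band [stu = su], so [g(s) = [sp = p]] qualifies, whence [qp = p] for all
    [q]; the mirror module gives [pq = p], and [q = qpq = p].
    Conversely, [l1] of a point has an identity [e] spanning it, and a
    derivation [D] is inner, implemented by [e . D(e) - D(e) . e]. *)
Require Import Defs.
From HB Require Import structures.
From mathcomp Require Import all_boot all_order all_algebra.
From mathcomp Require Import all_classical all_reals all_analysis.
From mathcomp Require Import finmap complex.
From mathcomp Require Import ring.
Import Order.TTheory GRing.Theory Num.Theory numFieldNormedType.Exports.
Set Implicit Arguments.
Unset Strict Implicit.
Unset Printing Implicit Defensive.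
Local Open Scope classical_set_scope.
Local Open Scope ring_scope.

(** * Completeness of the complex numbers *)

Section ComplexComplete.
Variable R : realType.
Local Notation C := (R[i] : numFieldType).

Lemma normc_ge_Im (z : R[i]) : (`|complex.Im z|%:C)%C <= `|z|.
Proof.
rewrite normc_def lecE /= eqxx /= -sqrtr_sqr ler_wsqrtr //.
by rewrite lerDr sqr_ge0.
Qed.

Lemma normc_le_Re_Im (z : R[i]) :
  `|z| <= ((`|complex.Re z| + `|complex.Im z|)%:C)%C.
Proof.
rewrite normc_def lecE /= eqxx /= -[leRHS]ger0_norm ?addr_ge0 // -sqrtr_sqr.
rewrite ler_wsqrtr // sqrrD !real_normK ?num_real //.
by rewrite lerD2r lerDl mulrn_wge0 ?mulr_ge0.
Qed.

(** A 1-Lipschitz map sends Cauchy filters to Cauchy filters, and [R] is complete. It serves for the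
    real and imaginary parts. *)
Lemma cvg_cauchy_comp_lipschitz (h : R[i] -> R) (F : set_system C^o) :
  (forall x y, (`|h x - h y|%:C)%C <= `|x - y|) ->
  ProperFilter F -> cauchy F -> cvg (h @ F).
Proof.
move=> hlip FF /cauchyP Fc; apply: R_complete; apply/cauchyP => e e0.
have e0C : 0 < (e%:C)%C :> C by rewrite ltcE /= eqxx.
have [x Fx] := Fc _ e0C; exists (h x).
rewrite /fmap /nbhs /=; apply: filterS Fx => y; rewrite /ball /= => xy.
have := le_lt_trans (hlip x y) xy.
by rewrite ltcE => /andP[].
Qed.

Lemma complex_complete (F : set_system C^o) :
  ProperFilter F -> cauchy F -> cvg F.
Proof.
move=> FF Fc.
have cRe : cvg (@complex.Re R @ F).
  apply: cvg_cauchy_comp_lipschitz => // x y.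
  by rewrite -raddfB; exact: normc_ge_Re.
have cIm : cvg (@complex.Im R @ F).
  apply: cvg_cauchy_comp_lipschitz => // x y.
  by rewrite -raddfB; exact: normc_ge_Im.
apply/cvg_ex.
exists (Complex (lim (@complex.Re R @ F)) (lim (@complex.Im R @ F))).
(* A positive complex [e] is real, so its real part is split between the two coordinates. *)
apply/cvgrPdist_le => /= e; rewrite ltcE /= => /andP[/eqP Ime e0].
have e2 : 0 < complex.Re e / 2 by rewrite divr_gt0.
near=> z.
apply: (le_trans (normc_le_Re_Im _)).
rewrite lecE /= Ime eqxx /= !raddfB /= [leRHS]splitr lerD //.
  by near: z; move/cvgrPdist_le: cRe; apply.
by near: z; move/cvgrPdist_le: cIm; apply.
Unshelve. all: by end_near. Qed.

(* An alias is needed: the [Complete] instance on [R^o] is already keyed to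
   [realType], so completeness of [C^o] would not be found by inference. *)
Definition complex_line : Type := C^o.
HB.instance Definition _ := NormedModule.copy complex_line C^o.
HB.instance Definition _ :=
  Uniform_isComplete.Build complex_line complex_complete.

End ComplexComplete.

(** * Absolutely summable families and their unconditional sums *)

Section UnconditionalSums.
Variable R : realType.
Local Notation C := (R[i] : numFieldType).

Definition abs_summable (I : choiceType) (x : I -> C) :=
  exists M : C, forall J : {fset I}, \sum_(i <- J) `|x i| <= M.

Section OneIndex.
Variable I : choiceType.
Implicit Types (x y : I -> C) (A B J : {fset I}).

Lemma abs_summable_le x y :
  (forall i, `|x i| <= `|y i|) -> abs_summable y -> abs_summable x.
Proof.
move=> xy [M yM]; exists M => J; apply: le_trans (yM J).
by apply: ler_sum.
Qed.

Lemma abs_summable_mulr_bounded x (g : I -> C) :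
  (forall i, `|g i| <= 1) -> abs_summable x ->
  abs_summable (fun i => x i * g i).
Proof.
by move=> g1; apply: abs_summable_le => i; rewrite normrM ler_piMr.
Qed.

Lemma sum_fsetD_fsubset x A B : (A `<=` B)%fset ->
  \sum_(i <- B) x i = \sum_(i <- A) x i + \sum_(i <- (B `\` A)%fset) x i.
Proof.
move=> AB; rewrite [LHS](big_fsetID _ (mem A)) /=.
have -> : [fset i in B | i \in A]%fset = A.
  apply/fsetP => i; rewrite !inE /= andbC.
  by case: (boolP (i \in A)) => //= /(fsubsetP AB).
by congr (_ + _); apply: eq_fbigl => i; rewrite !inE /= andbC.
Qed.

(** If the sum of norms over [A] is within [e] of the supremum of all such finite sums, a set
    disjoint from [A] can add at most [e]. The supremum is taken in [R], through real parts. *)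
Lemma abs_summable_tail x : abs_summable x -> forall e : C, 0 < e ->
  exists A, forall B, (forall i, i \in B -> i \notin A) ->
    \sum_(i <- B) `|x i| <= e.
Proof.
move=> [M xM] e e0.
have sumreal J :
    (complex.Re (\sum_(i <- J) `|x i|))%:C%C = \sum_(i <- J) `|x i|.
  by apply: RRe_real; apply: ger0_real; exact: sumr_ge0.
pose E := [set complex.Re (\sum_(i <- J) `|x i|) | J in [set: {fset I}]].
have supE : has_sup E.
  split; first by exists (complex.Re (\sum_(i <- fset0) `|x i|)), fset0.
  exists (complex.Re M) => _ [J _ <-].
  by have := xM J; rewrite lecE => /andP[].
move: e0; rewrite ltcE => /andP[/eqP /= Ime e0].
have [_ [A _ <-] HA] := sup_adherent e0 supE.
exists A => B disjAB.
have : complex.Re (\sum_(i <- (A `|` B)%fset) `|x i|) <= sup E.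
  by apply: sup_upper_bound => //; exists (A `|` B)%fset.
rewrite (sum_fsetD_fsubset _ (fsubsetUl A B)).
have -> : ((A `|` B) `\` A)%fset = B.
  apply/fsetP => i; rewrite !inE.
  case: (boolP (i \in B)) => [/disjAB ->|]; first by rewrite orbT.
  by rewrite orbF andNb.
rewrite raddfD /= => le_sup.
rewrite -sumreal lecE /= Ime eqxx /=.
rewrite -(lerD2l (complex.Re (\sum_(i <- A) `|x i|))).
by apply: (le_trans le_sup); rewrite -lerBlDr ltW.
Qed.

Lemma cvg_partial_sum x l : partial_sum x @ totally --> (l : C) <->
  forall e : C, 0 < e -> exists A, forall B, (A `<=` B)%fset ->
    `|l - \sum_(i <- B) x i| <= e.
Proof.
split=> [/cvgrPdist_le + e e0|H]; first by move=> /(_ e e0) [A _ HA]; exists A.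
by apply/cvgrPdist_le => e /H [A HA]; exists A.
Qed.

Lemma eq_usum x y : x =1 y -> usum x = usum y.
Proof. by move=> /funext ->. Qed.

Lemma usum_unique x l : partial_sum x @ totally --> (l : C) -> usum x = l.
Proof. by move=> xl; apply: cvg_lim => //; exact: norm_hausdorff. Qed.

Lemma cvg_usum x : abs_summable x -> partial_sum x @ totally --> (usum x : C).
Proof.
move=> xs; rewrite /usum.
(* The limit is sought in the alias, which carries the completeness instance. *)
suff : cvg (partial_sum x @ totally : set_system (complex_line R)) by [].
apply: cauchy_cvg; apply/cauchyP => e e0.
have e2 : 0 < e / 2 by rewrite divr_gt0.
have [A HA] := abs_summable_tail xs e2.
exists (\sum_(i <- A) x i : C); exists A => // B AB.
rewrite /ball /= /partial_sum (sum_fsetD_fsubset _ AB) opprD addNKr normrN.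
apply: (@le_lt_trans _ _ (e / 2)); last first.
  by rewrite ltr_pdivrMr // ltr_pMr // ltr1n.
apply: le_trans (HA (B `\` A)%fset _); first exact: ler_norm_sum.
by move=> i; rewrite !inE => /andP[].
Qed.

Lemma usum_norm_le x (M : C) : abs_summable x ->
  (forall J, \sum_(i <- J) `|x i| <= M) -> `|usum x| <= M.
Proof.
move=> xs xM; apply/ler_addgt0Pl => e e0.
have /cvg_partial_sum/(_ e e0) [A /(_ A (fsubset_refl A)) HA] := cvg_usum xs.
rewrite -(subrK (\sum_(i <- A) x i) (usum x)).
apply: le_trans (ler_normD _ _) _; apply: lerD => //.
by apply: le_trans (xM A); exact: ler_norm_sum.
Qed.

(* The order of [C] is not total, so nonnegativity of a limit is read off
   [`|c| = c]. *)
Lemma cvg_totally_ge0 (z : {fset I} -> C) (c : C) :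
  (forall J, 0 <= z J) -> z @ totally --> c -> 0 <= c.
Proof.
move=> z0 zc; have zc' : z @ totally --> `|c|.
  have -> : z = (fun J => `|z J|) by apply/funext => J; rewrite ger0_norm.
  exact: cvg_norm.
rewrite -(cvg_lim (@norm_hausdorff _ _) zc).
by rewrite (cvg_lim (@norm_hausdorff _ _) zc').
Qed.

Lemma usum_norm_le_usum x y : abs_summable x -> abs_summable y ->
  (forall i, `|x i| <= y i) -> `|usum x| <= usum y.
Proof.
move=> xs ys xy; rewrite -subr_ge0.
apply: cvg_totally_ge0 (cvgB (cvg_usum ys) (cvg_norm (cvg_usum xs))) => J.
rewrite /= /partial_sum subr_ge0; apply: le_trans (ler_norm_sum _ _ _) _.
apply: ler_sum => i _; exact: xy.
Qed.

Lemma usumD x y : abs_summable x -> abs_summable y ->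
  usum (fun i => x i + y i) = usum x + usum y.
Proof.
move=> xs ys; apply: usum_unique.
have -> : partial_sum (fun i => x i + y i) = partial_sum x + partial_sum y.
  by apply/funext => J; rewrite /partial_sum big_split.
exact: cvgD (cvg_usum xs) (cvg_usum ys).
Qed.

Lemma usumZ (k : C) x : abs_summable x ->
  usum (fun i => k * x i) = k * usum x.
Proof.
move=> xs; apply: usum_unique.
have -> : partial_sum (fun i => k * x i) = (fun J => k * partial_sum x J).
  by apply/funext => J; rewrite /partial_sum big_distrr.
exact: cvgM (cvg_cst k) (cvg_usum xs).
Qed.

Lemma usum_single x i0 : (forall i, i != i0 -> x i = 0) -> usum x = x i0.
Proof.
move=> x0; apply: usum_unique; apply/cvg_partial_sum => e e0.
exists [fset i0]%fset => B; rewrite fsub1set => i0B.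
rewrite (big_fsetD1 i0) //= big_seq big1 ?addr0 ?subrr ?normr0 ?ltW //.
by move=> i; rewrite !inE => /andP[/x0].
Qed.

End OneIndex.

(** * Regrouping a sum along the fibres of a map *)

Section Fibres.
Variables (I J : choiceType) (pi : I -> J) (x : I -> C).
Hypothesis xs : abs_summable x.

Let fibre (P : pred J) i := if P (pi i) then x i else 0.

Lemma abs_summable_if (P : pred I) :
  abs_summable (fun i => if P i then x i else 0).
Proof.
by apply: abs_summable_le xs => i; case: ifP; rewrite ?normr0.
Qed.

Lemma sum_usum_fibres (B : {fset J}) :
  \sum_(j <- B) usum (fibre (pred1 j)) = usum (fibre (mem B)).
Proof.
elim/fset1U_rect: B => [|j B jB IH].
  rewrite big_seq_fset0 (@usum_unique _ _ 0) //; apply/cvg_partial_sum => e e0.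
  by exists fset0 => A _; rewrite big1 // subrr normr0 ltW.
rewrite big_fsetU1 //= IH -usumD; [|exact: abs_summable_if..].
apply: eq_usum => i; rewrite /fibre /= !inE.
by case: eqP => [->|] /=; rewrite ?(negPf jB) ?addr0 ?add0r.
Qed.

(** Take [A] outside which the norms sum to at most [e]. Once [B] contains the image of [A], the
    indices not yet counted all lie outside [A]. *)
Lemma cvg_usum_fibres :
  partial_sum (fun j => usum (fun i => if pi i == j then x i else 0))
    @ totally --> (usum x : C).
Proof.
apply/cvg_partial_sum => e e0.
have [A HA] := abs_summable_tail xs e0.
exists [fset pi i | i in A]%fset => B AB.
rewrite sum_usum_fibres.
have -> : usum x = usum (fibre (mem B)) + usum (fibre (predC (mem B))).
  rewrite -usumD; [|exact: abs_summable_if..].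
  apply: eq_usum => i; rewrite /fibre /=.
  by case: ifP; rewrite ?addr0 ?add0r.
rewrite addrC addKr.
apply: usum_norm_le; first exact: abs_summable_if.
move=> J0.
rewrite (bigID (fun i => pi i \in B)) /= big1 ?add0r; last first.
  by move=> i iB; rewrite /fibre /= iB normr0.
rewrite big_fset_condE.
apply: le_trans (HA [fset i in J0 | pi i \notin B]%fset _).
  by apply: ler_sum => i _; rewrite /fibre; case: ifP; rewrite ?normr0.
move=> i; rewrite !inE /= => /andP[_]; apply: contra => iA.
by apply: (fsubsetP AB); exact: in_imfset.
Qed.

End Fibres.
End UnconditionalSums.

(** * Products of sums as sums over pairs *)

Section ProductSums.
Variable R : realType.
Local Notation C := (R[i] : numFieldType).
Variables (I J : choiceType) (a : I -> C) (b : J -> C).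
Hypotheses (sa : abs_summable a) (sb : abs_summable b).

Lemma abs_summable_prod : abs_summable (fun p : I * J => a p.1 * b p.2).
Proof.
have [M aM] := sa; have [N bN] := sb; exists (M * N) => A.
have N0 : 0 <= N by apply: le_trans (bN fset0); rewrite big_seq_fset0.
apply: (@le_trans _ _ (\sum_(i <- [fset p.1 | p in A]%fset) `|a i| * N));
  last first.
  by rewrite -mulr_suml ler_wpM2r.
rewrite (partition_big_imfset _ fst); apply: ler_sum => i _.
rewrite big_fset_condE /=.
apply: (@le_trans _ _
  (\sum_(p <- [fset p in A | p.1 == i]%fset) `|a i| * `|b p.2|)).
  rewrite big_seq [leRHS]big_seq; apply: ler_sum => p.
  by rewrite !inE /= => /andP[_ /eqP <-]; rewrite normrM.
rewrite -mulr_sumr ler_wpM2l //.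
(* Pairs with first coordinate [i] are told apart by the second, so the bound [N] for [b]
   applies. *)
apply: le_trans (bN [fset p.2 | p in [fset p in A | p.1 == i]]%fset).
rewrite [leRHS]big_imfset //= => -[i1 j1] [i2 j2] /=; rewrite !inE /=.
by move=> /andP[_ /eqP ->] /andP[_ /eqP ->] ->.
Qed.

(** Regrouping along [fst], then along [snd], leaves fibres that are single points. *)
Lemma usum_prod : usum (fun p : I * J => a p.1 * b p.2) = usum a * usum b.
Proof.
have sab := abs_summable_prod.
rewrite -(usum_unique (cvg_usum_fibres fst sab)) mulrC -usumZ //.
apply: eq_usum => i; rewrite [RHS]mulrC -usumZ //.
have sabi := abs_summable_if sab (fun p => p.1 == i).
rewrite -(usum_unique (cvg_usum_fibres snd sabi)).
apply: eq_usum => j; rewrite (@usum_single _ _ _ (i, j)) /= ?eqxx //.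
move=> [i1 j1] /= neq; case: eqP => // j1j; case: eqP => // i1i.
by rewrite i1i j1j eqxx in neq.
Qed.

End ProductSums.

(** * The middle factor in a rectangular band *)

Section RectangularBand.
Variables (S : Type) (op : S -> S -> S).
Hypothesis band : rectangular_band op.

(** Write the last factor as [u = usu]; then [st(usu) = (s(tu)s)u = su]. *)
Lemma rectangular_band_mid s t u : op (op s t) u = op s u.
Proof.
have [opA _ opK] := band.
by rewrite -[u in LHS](opK u s) !opA -(opA s t u) opK.
Qed.

End RectangularBand.

(** * Bounded functions as functionals on the Beurling algebra, and derivations *)

Section BeurlingAlgebra.
Variables (R : realType) (S : choiceType) (op : S -> S -> S) (w : S -> R).
Local Notation C := (R[i] : numFieldType).
Hypotheses (opI : forall s, op s s = s) (ww : is_weight op w).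

Lemma wC_gt0 s : 0 < wC w s.
Proof. by rewrite /wC ltcE /= eqxx ww.1. Qed.

(** Idempotence gives [w s = w (ss) <= w s * w s]; divide by [w s > 0]. *)
Lemma wC_ge1 s : 1 <= wC w s.
Proof.
have [w0 wM] := ww.
have := wM s s; rewrite opI ler_pMr // => w1.
by rewrite /wC lecE /= eqxx.
Qed.

Lemma in_l1_summable (f : S -> C) :
  in_l1 w f -> abs_summable (fun s => `|f s| * wC w s).
Proof.
move=> [M fM]; exists M => J; apply: le_trans (fM J).
apply: ler_sum => s _; rewrite normrM normr_id.
by rewrite (ger0_norm (ltW (wC_gt0 s))).
Qed.

Lemma in_l1_abs_summable (f : S -> C) : in_l1 w f -> abs_summable f.
Proof.
move=> /in_l1_summable; apply: abs_summable_le => s.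
rewrite normrM normr_id (ger0_norm (ltW (wC_gt0 s))).
by rewrite ler_peMr // wC_ge1.
Qed.

Lemma in_l1_single (f : S -> C) s0 :
  (forall s, s != s0 -> f s = 0) -> in_l1 w f.
Proof.
move=> f0; have fw0 : 0 <= `|f s0| * wC w s0 by rewrite mulr_ge0 // ltW ?wC_gt0.
exists (`|f s0| * wC w s0) => J.
have z (K : {fset S}) : s0 \notin K -> \sum_(s <- K) `|f s| * wC w s = 0.
  move=> s0K; rewrite big_seq big1 // => s sK.
  rewrite f0 ?normr0 ?mul0r //.
  by apply: contraNneq s0K => <-.
have [s0J|/z ->//] := boolP (s0 \in J).
by rewrite (big_fsetD1 s0) //= z ?addr0 // !inE eqxx.
Qed.

(** The functional on l1 induced by [g]; the constant [1] gives the augmentation character. *)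
Definition pairing (g a : S -> C) : C := usum (fun s => a s * g s).

Section Pairing.
Variable g : S -> C.
Hypothesis g1 : forall s, `|g s| <= 1.

Lemma abs_summable_pairing (a : S -> C) :
  in_l1 w a -> abs_summable (fun s => a s * g s).
Proof.
by move=> /in_l1_abs_summable ?; exact: abs_summable_mulr_bounded.
Qed.

Lemma pairingD (a b : S -> C) : in_l1 w a -> in_l1 w b ->
  pairing g (a + b) = pairing g a + pairing g b.
Proof.
move=> la lb; rewrite /pairing -usumD; [|exact: abs_summable_pairing..].
by apply: eq_usum => s; rewrite -mulrDl.
Qed.

Lemma pairingZ (k : C) (a : S -> C) : in_l1 w a ->
  pairing g (k *: a) = k * pairing g a.
Proof.
move=> la; rewrite /pairing -usumZ; last exact: abs_summable_pairing.
by apply: eq_usum => s; rewrite mulrA.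
Qed.

Lemma pairing_le (a : S -> C) : in_l1 w a -> `|pairing g a| <= l1norm w a.
Proof.
move=> la; apply: usum_norm_le_usum => [||s].
- exact: abs_summable_pairing.
- exact: in_l1_summable.
by rewrite normrM ler_pM // (le_trans (g1 s)) // wC_ge1.
Qed.

Lemma pairing_delta s : pairing g (fun t => (t == s)%:R) = g s.
Proof.
rewrite /pairing (@usum_single _ _ _ s) ?eqxx ?mul1r // => t /negPf ->.
by rewrite mul0r.
Qed.

(** Regroup the pairs along the product map: the fibre over [u] contributes the convolution at [u]
    times [g u]. Identities for functionals thus reduce to pointwise identities on [S]. *)
Lemma pairing_conv (a b : S -> C) : in_l1 w a -> in_l1 w b ->
  pairing g (Defs.conv op a b) =
  usum (fun p : S * S => a p.1 * b p.2 * g (op p.1 p.2)).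
Proof.
move=> /in_l1_abs_summable sa /in_l1_abs_summable sb.
have sab := abs_summable_prod sa sb.
have sabg : abs_summable (fun p : S * S => a p.1 * b p.2 * g (op p.1 p.2)).
  exact: (abs_summable_mulr_bounded (g := fun p => g (op p.1 p.2))).
rewrite -(usum_unique (cvg_usum_fibres (fun p => op p.1 p.2) sabg)).
apply: eq_usum => u; rewrite mulrC /Defs.conv -usumZ;
  last exact: (abs_summable_if sab).
by apply: eq_usum => p; case: eqP => [->|]; rewrite ?mulr0 // mulrC.
Qed.

End Pairing.

(* The bimodule is one-dimensional: [l1] acts on [C] from the left by the
   character [gl] and from the right by [gr]. *)
Lemma amenable_point_derivation (gl gr gd : S -> C) :
  (forall s, `|gl s| <= 1) -> (forall s, `|gr s| <= 1) ->
  (forall s, `|gd s| <= 1) ->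
  (forall s t, gl (op s t) = gl s * gl t) ->
  (forall s t, gr (op s t) = gr s * gr t) ->
  (forall s t, gd (op s t) = gr s * gd t + gd s * gl t) ->
  beurling_amenable op w -> exists c : C, forall s, gd s = c * (gr s - gl s).
Proof.
move=> gl1 gr1 gd1 glM grM gdM amen.
have charM g : (forall s, `|g s| <= 1) ->
    (forall s t, g (op s t) = g s * g t) -> forall a b : S -> C,
    in_l1 w a -> in_l1 w b ->
    pairing g (Defs.conv op a b) = pairing g a * pairing g b.
  move=> g1 gM a b la lb; rewrite pairing_conv // -usum_prod.
  - by apply: eq_usum => p; rewrite gM mulrACA.
  - exact: abs_summable_pairing.
  - exact: abs_summable_pairing.
pose la (a : S -> C) (x : complex_line R) : complex_line R := pairing gl a *: x.
pose ra (x : complex_line R) (a : S -> C) : complex_line R := pairing gr a *: x.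
pose D (a : S -> C) (x : complex_line R) : C := pairing gd a * (x : C).
have bim : banach_bimodule (in_l1 w) (l1norm w) (Defs.conv op) la ra.
  split.
  - split.
    + by move=> a b x aA bA; rewrite /la pairingD // scalerDl.
    + by move=> k a x aA; rewrite /la pairingZ // scalerA.
    + by move=> a x y aA; rewrite /la scalerDr.
    + by move=> k a x aA; rewrite /la !scalerA mulrC.
  - split.
    + by move=> a b x aA bA; rewrite /ra pairingD // scalerDl.
    + by move=> k a x aA; rewrite /ra pairingZ // scalerA.
    + by move=> a x y aA; rewrite /ra scalerDr.
    + by move=> k a x aA; rewrite /ra !scalerA mulrC.
  - split.
    + by move=> a b x aA bA; rewrite /la charM // scalerA.
    + by move=> a b x aA bA; rewrite /ra charM // scalerA mulrC.
    + by move=> a b x aA bA; rewrite /ra /la !scalerA mulrC.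
  exists 1 => a x aA; rewrite mul1r /la /ra !normrZ.
  by split; apply: ler_wpM2r => //; apply: pairing_le.
have der : bdd_derivation (in_l1 w) (l1norm w) (Defs.conv op) la ra D.
  split.
  - move=> a aA; split => [x y|k x|]; rewrite /D ?mulrDr //.
      by rewrite mulrCA.
    by exists `|pairing gd a| => x; rewrite normrM.
  - by move=> a b x aA bA; rewrite /D pairingD // mulrDl.
  - by move=> k a x aA; rewrite /D pairingZ // mulrA.
  - exists 1 => a x aA; rewrite mul1r /D normrM.
    by apply: ler_wpM2r => //; apply: pairing_le.
  - move=> a b x aA bA; rewrite /D /ra /la /= pairing_conv //.
    have [sra sda] := (abs_summable_pairing gr1 aA, abs_summable_pairing gd1 aA).
    have [sdb slb] := (abs_summable_pairing gd1 bA, abs_summable_pairing gl1 bA).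
    (* The pointwise Leibniz rule for [gd] splits the double sum into two, each a product of single
       sums. *)
    rewrite (eq_usum (y := fun p : S * S =>
      (a p.1 * gr p.1) * (b p.2 * gd p.2) +
      (a p.1 * gd p.1) * (b p.2 * gl p.2))); last first.
      by move=> p; rewrite gdM mulrDr mulrACA (mulrACA _ _ (gd p.1)).
    rewrite (usumD (abs_summable_prod sra sdb) (abs_summable_prod sda slb)).
    rewrite (usum_prod sra sdb) (usum_prod sda slb) mulrDl -/(pairing gr a) -/(pairing gd b).
    by rewrite -/(pairing gd a) -/(pairing gl b) (mulrC (pairing gr a)) -!mulrA.
have [phi [[_ phiZ _] Dphi]] := amen _ _ _ bim _ der.
(* A linear functional on the line is fixed by its value at [1]; evaluating at the point mass of [s]
   and at [1] reads off [gd s]. *)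
exists (phi (1 : C)) => s.
have dA : in_l1 w (fun t => (t == s)%:R).
  by apply: (in_l1_single (s0 := s)) => t /negPf ->.
have := Dphi _ (1 : C) dA.
rewrite /D /ra /la !phiZ !pairing_delta // mulr1 => ->.
by rewrite mulrBr !(mulrC (phi _)).
Qed.

(** The identity [e] need not act on [E] as the identity map, so [D e] can be nonzero; the
    idempotence of [e] determines it enough to find [phi]. *)
Lemma beurling_amenable_singleton s0 :
  (forall s : S, s = s0) -> beurling_amenable op w.
Proof.
move=> S1 E la ra [[_ laZ laD laZr] [_ raZ raD raZr] [laM raM lra] [c0 bnd]].
move=> D [Dfun _ DZ _ DM].
(* On one point this is the point mass at [s0]. *)
pose e : S -> C := fun=> 1.
have inA (a : S -> C) : in_l1 w a.
  by apply: (in_l1_single (s0 := s0)) => s; rewrite (S1 s) eqxx.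
have ee : Defs.conv op e e = e.
  apply/funext => u; rewrite /Defs.conv (@usum_single _ _ _ (s0, s0)) /=.
    by rewrite (S1 (op s0 s0)) (S1 u) eqxx mulr1.
  by move=> [s t]; rewrite (S1 s) (S1 t) eqxx.
have aE (a : S -> C) : a = a s0 *: e.
  by apply/funext => s; rewrite (S1 s) -[LHS]mulr1.
have [DeD DeZ [c Dec]] := Dfun e (inA e).
have DeM x : D e x = D e (ra x e) + D e (la e x) by rewrite -DM // ee.
have lee x : la e (la e x) = la e x by rewrite -laM // ee.
have ree x : ra (ra x e) e = ra x e by rewrite -raM // ee.
(* The derivation rule at [e x e] gives [D e (e x e) = 2 D e (e x e)]. *)
have De0 x : D e (la e (ra x e)) = 0.
  have := DeM (la e (ra x e)).
  rewrite lee lra // ree => /eqP.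
  by rewrite -subr_eq0 opprD addNKr oppr_eq0 => /eqP.
(* The sign of [c] is unknown; a nonnegative constant lets the bounds be composed. *)
have Dec' x : `|D e x| <= `|c| * `|x|.
  apply: le_trans (Dec x) _.
  have := le_trans (normr_ge0 _) (Dec x) => h.
  by rewrite -(ger0_norm h) normrM normr_id.
exists (fun x => D e (ra x e) - D e (la e x)); split; first split.
- by move=> x y; rewrite raD // laD // !DeD opprD addrACA.
- by move=> k x; rewrite raZr // laZr // !DeZ mulrBr.
- exists (`|c| * (c0 * l1norm w e) + `|c| * (c0 * l1norm w e)) => x.
  have [bl br] := bnd e x (inA e).
  apply: le_trans (ler_normB _ _) _; rewrite mulrDl -!mulrA; apply: lerD.
    by apply: le_trans (Dec' _) _; rewrite ler_wpM2l // mulrA.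
  by apply: le_trans (Dec' _) _; rewrite ler_wpM2l // mulrA.
move=> a x _; rewrite (aE a) DZ // raZ // laZ // raZr // laZr //.
(* Up to the factor [a s0], the right side is [D e (xe) - 2 D e (exe) + D e (ex)], whose middle term
   vanishes and whose outer terms sum to [D e x]. *)
rewrite raZr // laZr // !DeZ ree lee lra // De0 DeM; ring.
Qed.

End BeurlingAlgebra.

Theorem theorem2p4 (R : realType) (S : choiceType) (op : S -> S -> S)
    (w : S -> R) :
  rectangular_band op -> is_weight op w -> (exists s : S, True) ->
  (beurling_amenable op w <-> exists s0 : S, forall s : S, s = s0).
Proof.
move=> band ww [p _]; have [opA opI opK] := band; split; last first.
  by move=> [s0 S1]; exact: (beurling_amenable_singleton ww S1).
move=> amen; exists p => q.
have mid := rectangular_band_mid band.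
have b1 (b : bool) : `|b%:R : (R[i] : numFieldType)| <= 1.
  by case: b; rewrite ?normr1 ?normr0 ?ler01.
have n0 : `|0 : (R[i] : numFieldType)| <= 1 by rewrite normr0 ler01.
have n1 : `|1 : (R[i] : numFieldType)| <= 1 by rewrite normr1.
(* The indicator of [sp = p] satisfies [gd (st) = gd s] because [stp = sp]. Being a multiple of a
   constant, it takes at [q] its value [1] at [p]. *)
have qp : op q p = p.
  have [|||||||c Hc] := @amenable_point_derivation R S op w opI ww
    (fun=> 1) (fun=> 0) (fun s => (op s p == p)%:R) => //.
  - by move=> s t; rewrite mulr1.
  - by move=> s t; rewrite mulr0.
  - by move=> s t; rewrite mul0r add0r mulr1 mid.
  have := Hc q; rewrite -(Hc p) opI eqxx.
  by case: eqP => // _ /eqP; rewrite eq_sym oner_eq0.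
(* With the two characters exchanged, the condition becomes [gd (st) = gd t], which holds because
   [pst = pt]. *)
have pq : op p q = p.
  have [|||||||c Hc] := @amenable_point_derivation R S op w opI ww
    (fun=> 0) (fun=> 1) (fun s => (op p s == p)%:R) => //.
  - by move=> s t; rewrite mulr0.
  - by move=> s t; rewrite mulr1.
  - by move=> s t; rewrite mulr0 addr0 mul1r opA mid.
  have := Hc q; rewrite -(Hc p) opI eqxx.
  by case: eqP => // _ /eqP; rewrite eq_sym oner_eq0.
by rewrite -(opK q p) qp.
Qed.
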